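(* Let $(H_w,H_r)$ be a target pair with $b_w=3$ satisfying dominance. Put $H=H_w(3)$ and let $\mathcal V$ be the set of positive vertices of $H_w$. Assume $b_r\ge1$ and $h_3\le\rho_1$. Suppose $\lambda_1\ge\lambda_2>0$ are rational, $\lambda_1+\lambda_2=H-\rho_1$, and $$\lambda_1\le h_1,\qquad \lambda_1+\rho_1\le H_w(2),\qquad H_r(b_r)\le\lambda_2+\rho_1.$$ If $2\in\mathcal V$, assume additionally that at least one of the following holds: $$h_3=\rho_1;\qquad \lambda_1=H_w(2)-\rho_1;\qquad \bigl(\lambda_1\ge\max\{h_2,\rho_1\}\ \text{and}\ H_r(b_r)\le\lambda_1+h_3\bigr).$$ Then the pair is realizable.
   Context: An instance consists of a finite set $E$ of items with rational values $a_i\ge 0$, positive integer sizes $d_i$, and integer capacities $0\le R<D$, with $d_i\le D$ for every item. Write $G(S)=\sum_{i\in S}a_i$ and $d(S)=\sum_{i\in S}d_i$. For $\alpha\in\{w,r\}$ let $U^\alpha(n)$ be the maximum of $G(S)$ over $n$-element sets $S\subseteq E$ with $d(S)\le D$ (for $\alpha=w$) or $d(S)\le R$ (for $\alpha=r$), with value $-\infty$ if there is none; $U^\alpha(0)=0$. The terminal count is $b_\alpha=\min\operatorname{arg\,max}_n U^\alpha(n)$. The hull is the sequence on $\{0,\dots,b_\alpha\}$ obtained by evaluating at integers the upper concave hull of the points $(n,U^\alpha(n))$, $0\le n\le b_\alpha$. A target pair $(H_w,H_r)$ consists of strictly increasing concave rational sequences $H_\alpha$ on $\{0,\dots,b_\alpha\}$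 with $H_\alpha(0)=0$ (the zero sequence $(0)$, with $b_\alpha=0$, is allowed). It is realizable if a single instance has terminal counts $b_w,b_r$ and hulls exactly $H_w$ and $H_r$. There is no cardinality cap. Notation. $h_n=H_w(n)-H_w(n-1)$, $\rho_m=H_r(m)-H_r(m-1)$. A positive count $n\le b_w$ is a vertex of $H_w$ if $n=b_w$ or $h_n\ne h_{n+1}$. Dominance means $H_r(k)\le H_w(\min\{k,b_w\})$ for $0\le k\le b_r$. *)

(* Defs.v *)
From HB Require Import structures.
From mathcomp Require Import all_boot all_order all_algebra.
From mathcomp Require Import constructive_ereal.

Set Implicit Arguments.
Unset Strict Implicit.
Unset Printing Implicit Defensive.

Import Order.TTheory GRing.Theory Num.Theory.
Local Open Scope ring_scope.

Record instance := Instance {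
  item : finType;
  gain : item -> rat;
  size_of : item -> nat;
  Rcap : nat;
  Dcap : nat;
  gain_ge0 : forall i, 0 <= gain i;
  size_of_gt0 : forall i, (0 < size_of i)%N;
  Rcap_lt_Dcap : (Rcap < Dcap)%N;
  size_of_le_Dcap : forall i, (size_of i <= Dcap)%N
}.

Definition set_gain (I : instance) (S : {set item I}) : rat :=
  \sum_(i in S) gain i.

Definition set_size (I : instance) (S : {set item I}) : nat :=
  (\sum_(i in S) size_of i)%N.

(* The maximum over the empty family is -oo; at n = 0 the only candidate is
   the empty set, so the value there is 0. *)
Definition Umax (I : instance) (C n : nat) : \bar rat :=
  \big[Order.max/-oo%E]_(S : {set item I} | (#|S| == n) && (set_size S <= C)%N)
    (set_gain S)%:E.

Definition Uw (I : instance) : nat -> \bar rat := Umax I (Dcap I).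
Definition Ur (I : instance) : nat -> \bar rat := Umax I (Rcap I).

Definition is_argmax (U : nat -> \bar rat) (n : nat) : Prop :=
  forall k : nat, (U k <= U n)%E.

Definition terminal_count (U : nat -> \bar rat) (b : nat) : Prop :=
  is_argmax U b /\ forall n : nat, is_argmax U n -> (b <= n)%N.

(* (x, y) is a convex combination of the points (k, U k), 0 <= k <= b.  In
   \bar rat one has 0 * -oo = 0, and a positive weight on a point with
   U k = -oo makes the sum -oo; so such points are not used. *)
Definition in_conv (U : nat -> \bar rat) (b : nat) (x y : rat) : Prop :=
  exists c : 'I_b.+1 -> rat,
    [/\ forall k, 0 <= c k,
        \sum_k c k = 1,
        \sum_k c k * (k : nat)%:R = x
      & (\sum_k (c k)%:E * U k)%E = y%:E].

(* The upper concave hull at x is the top of the convex hull above x. *)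
Definition upper_hull_at (U : nat -> \bar rat) (b : nat) (x y : rat) : Prop :=
  in_conv U b x y /\ forall y' : rat, in_conv U b x y' -> y' <= y.

(* A sequence on {0, ..., b} is given by a function on nat whose values
   beyond b are irrelevant, here and below. *)
Definition is_hull (U : nat -> \bar rat) (b : nat) (H : nat -> rat) : Prop :=
  forall n : nat, (n <= b)%N -> upper_hull_at U b n%:R (H n).

(* Meaningful for n > 0 only. *)
Definition incr (H : nat -> rat) (n : nat) : rat := H n - H n.-1.

Definition target_seq (b : nat) (H : nat -> rat) : Prop :=
  [/\ H 0%N = 0,
      forall m n : nat, (m < n <= b)%N -> H m < H n
    & forall n : nat, (0 < n < b)%N -> incr H n.+1 <= incr H n].

Definition target_pair (bw br : nat) (Hw Hr : nat -> rat) : Prop :=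
  target_seq bw Hw /\ target_seq br Hr.

Definition realizable (bw br : nat) (Hw Hr : nat -> rat) : Prop :=
  exists I : instance,
    [/\ terminal_count (Uw I) bw, terminal_count (Ur I) br,
        is_hull (Uw I) bw Hw & is_hull (Ur I) br Hr].

Definition pos_vertex (b : nat) (H : nat -> rat) (n : nat) : Prop :=
  (0 < n <= b)%N /\ (n = b \/ incr H n <> incr H n.+1).

Definition dominance (bw br : nat) (Hw Hr : nat -> rat) : Prop :=
  forall k : nat, (k <= br)%N -> Hr k <= Hw (minn k bw).

(* Main.v *)
Require Import Defs.
From HB Require Import structures.
From mathcomp Require Import all_boot all_order all_algebra.
From mathcomp Require Import constructive_ereal.
From mathcomp Require Import zify lra.

Set Implicit Arguments.
Unset Strict Implicit.
Unset Printing Implicit Defensive.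

Import Order.TTheory GRing.Theory Num.Theory.
Local Open Scope ring_scope.

(** The pair is realized by one explicit instance. It has [br] unit-size items
    whose gains are the increments of [Hr], and four large items: one of gain
    [Hw 1] that fills the large capacity [D = 2 br + 3] alone, two of size
    [br + 1] with gains [lambda1] and [lambda2], and a partner item of size
    [br + 2] with a gain [q] to be chosen. The small capacity is [R = br].

    All large items exceed [R], while all unit items together fill it exactly,
    so the optimal values under [R] are the prefix sums of the increments,
    that is, [Hr] itself ([gadget_reserve]).

    Under [D] the sizes leave few possibilities: the solitary item; unit items
    alone, bounded by dominance; at most one other large item with any number
    of unit items; the two [lambda] items with at most one unit item; or one
    [lambda] item with the partner and nothing else. The hypotheses
    put each of these below [Hw] ([gadget_upper]). Equality holds at
    count 1 by the solitary item, and at count 3 by the two [lambda] items and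
    the best unit item, as [lambda1 + lambda2 + Hr 1 = Hw 3] ([gadget_work]).

    Count 2 must be attained only if it is a vertex of [Hw]. Each alternative of
    the last hypothesis supplies a pair of gain [Hw 2]. If [incr Hw 3 = Hr 1],
    it consists of the two [lambda] items; if [lambda1 = Hw 2 - Hr 1], of the
    first [lambda] item and the best unit item. In these cases the partner is
    idle and [q = 0] will do. In the third case [q = Hw 2 - lambda1], and the
    partner is paired with the first [lambda] item: [incr Hw 2 <= lambda1],
    [Hr 1 <= lambda1] and [Hr br <= lambda1 + incr Hw 3] say respectively that
    the partner does not exceed [Hw] by itself, with one unit item, and with all
    the unit items.

    The passage from attained values to hulls is [terminal_hull]: a concave
    majorant that is attained at its kinks and at its last index is the hull. *)

(** * Concave sequences and their hulls *)

Lemma incr_anti (b : nat) (H : nat -> rat) (m n : nat) :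
  target_seq b H -> (0 < m <= n)%N -> (n <= b)%N -> incr H n <= incr H m.
Proof.
case=> _ _ Hcc /andP[m0 lemn]; rewrite -(subnKC lemn).
elim: (n - m)%N => [|d IHd] hb; first by rewrite addn0.
rewrite addnS in hb *; apply: le_trans (IHd (ltnW hb)).
by apply: Hcc; lia.
Qed.

Lemma incr_gt0 (b : nat) (H : nat -> rat) (n : nat) :
  target_seq b H -> (0 < n <= b)%N -> 0 < incr H n.
Proof. by case=> _ Hs _ hn; rewrite subr_gt0; apply: Hs; lia. Qed.

Lemma target_seq_le (b : nat) (H : nat -> rat) (m n : nat) :
  target_seq b H -> (m <= n <= b)%N -> H m <= H n.
Proof.
case=> _ Hs _ /andP[]; rewrite leq_eqVlt => /orP[/eqP-> //|ltmn] lenb.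
by apply/ltW/Hs; rewrite ltmn.
Qed.

(** The slope is the increment after [n] when [n = 0], and the increment before
    [n] otherwise, so that the end point [n = b] needs no separate treatment. *)
Lemma supporting_line (b : nat) (H : nat -> rat) (n : nat) :
  target_seq b H -> (n <= b)%N ->
  exists s : rat, forall k : nat, (k <= b)%N -> H k <= H n + s * (k%:R - n%:R).
Proof.
move=> tH lenb.
have [->|n0] := posnP n.
  exists (incr H 1); elim=> [_|k IHk hk]; first by rewrite subrr mulr0 addr0.
  have := IHk (ltnW hk); have : incr H k.+1 <= incr H 1 by apply: (incr_anti tH).
  rewrite {1}/incr /= -[k.+1]addn1 natrD; lra.
exists (incr H n) => k lekb.
have [lekn|/ltnW lenk] := leqP k n.
  (* induction on the distance to n, moving left *)
  move: lekb; rewrite -(subKn lekn); move: (leq_subr k n).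
  elim: (n - k)%N => [|d IHd] hd _; first by rewrite subn0 subrr mulr0 addr0.
  have := IHd (ltnW hd) (leq_trans (leq_subr _ _) lenb).
  have : incr H n <= incr H (n - d) by apply: (incr_anti tH); lia.
  have -> : (n - d = (n - d.+1).+1)%N by lia.
  rewrite {2}/incr /= -[(n - d.+1).+1]addn1 natrD; lra.
move: lekb; rewrite -(subnKC lenk).
elim: (k - n)%N => [|d IHd] hd; first by rewrite addn0 subrr mulr0 addr0.
rewrite addnS in hd *; have := IHd (ltnW hd).
have : incr H (n + d).+1 <= incr H n by apply: (incr_anti tH); lia.
rewrite {1}/incr /= -[(n + d).+1]addn1 natrD; lra.
Qed.

(** Averaging the points of the graph of [H] with the weights of a convex
    combination keeps them below the supporting line at [n]. *)
Lemma in_conv_le (U : nat -> \bar rat) (b : nat) (H : nat -> rat) (n : nat)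
    (y : rat) :
  target_seq b H -> (n <= b)%N ->
  (forall k, (k <= b)%N -> (U k <= (H k)%:E)%E) ->
  in_conv U b n%:R y -> y <= H n.
Proof.
move=> tH lenb UH [c [c0 c1 cn cU]].
have [s Hs] := supporting_line tH lenb.
have : (y%:E <= (\sum_k c k * H k)%:E)%E.
  rewrite -cU -sumEFin; apply: lee_sum => k _.
  by rewrite EFinM; apply: lee_wpmul2l; rewrite ?lee_fin ?UH // -ltnS.
rewrite lee_fin => /le_trans; apply.
have -> : H n = \sum_k c k * (H n + s * ((k : nat)%:R - n%:R)).
  transitivity (\sum_k (c k * (H n - s * n%:R) + s * (c k * (k : nat)%:R))).
    by rewrite big_split /= -mulr_suml -mulr_sumr c1 cn; lra.
  by apply: eq_bigr => k _; lra.
by apply: ler_sum => k _; apply: ler_wpM2l; rewrite ?c0 // Hs // -ltnS.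
Qed.

(** The weights are one half at [k] and one half at [l], added up so that the
    case [k = l] gives the points of the graph themselves. Elsewhere the weight
    is 0, and the value of [U] may be infinite. *)
Lemma in_conv_mid (U : nat -> \bar rat) (b : nat) (H : nat -> rat)
    (k l n : nat) :
  (k <= b)%N -> (l <= b)%N -> (k + l = n.*2)%N ->
  U k = (H k)%:E -> U l = (H l)%:E -> H k + H l = H n *+ 2 ->
  in_conv U b n%:R (H n).
Proof.
move=> lekb lelb kln Uk Ul Hkl.
pose c (i : 'I_b.+1) : rat := ((i == k :> nat)%:R + (i == l :> nat)%:R) / 2.
have csum (f : nat -> rat) : \sum_i c i * f i = (f k + f l) / 2.
  have one j : (j <= b)%N -> \sum_(i < b.+1) (i == j :> nat)%:R * f i = f j.
    move=> lejb; rewrite (bigD1 (Ordinal (lejb : (j < b.+1)%N))) //= eqxx mul1r.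
    rewrite big1 ?addr0 // => i; rewrite -val_eqE /= => /negPf->.
    by rewrite mul0r.
  transitivity (\sum_(i < b.+1) ((i == k :> nat)%:R * f i
                                + (i == l :> nat)%:R * f i) / 2).
    by apply: eq_bigr => i _; rewrite /c; lra.
  by rewrite -mulr_suml big_split /= !one.
exists c; split=> [i||| ].
- by rewrite /c divr_ge0 // addr_ge0.
- by under eq_bigr => i _ do rewrite -[c i]mulr1; rewrite (csum (fun=> 1)); lra.
- by rewrite (csum (fun i => i%:R)) -natrD kln -mul2n natrM; lra.
- have -> : H n = \sum_i c i * H i by rewrite (csum H) Hkl; lra.
  rewrite -sumEFin; apply: eq_bigr => i _; rewrite EFinM.
  rewrite /c; case: eqP => [->|_]; first by rewrite Uk.
  case: eqP => [->|_]; first by rewrite Ul.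
  by rewrite add0r mul0r !mul0e.
Qed.

(** A count without a kink needs no optimal set of its own value: the hull
    interpolates between its two neighbours. *)
Lemma terminal_hull (U : nat -> \bar rat) (b : nat) (H : nat -> rat) :
  target_seq b H ->
  (forall n, (U n <= (H (minn n b))%:E)%E) ->
  U b = (H b)%:E ->
  (forall n, (n < b)%N -> U n = (H n)%:E \/
     [/\ (0 < n)%N, U n.-1 = (H n.-1)%:E, U n.+1 = (H n.+1)%:E
       & incr H n = incr H n.+1]) ->
  terminal_count U b /\ is_hull U b H.
Proof.
move=> tH UH Ub contact; split; first split.
- by move=> k; rewrite Ub (le_trans (UH k)) // lee_fin (target_seq_le tH) //; lia.
- move=> n amax; rewrite leqNgt; apply/negP => ltnb.
  have := le_trans (amax b) (UH n); rewrite Ub lee_fin leNgt => /negP; apply.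
  by case: tH => _ Hs _; apply: Hs; lia.
move=> n lenb; split=> [|y]; last first.
  by apply: (in_conv_le tH) => // k lekb; have := UH k; rewrite (minn_idPl lekb).
have graph : U n = (H n)%:E -> in_conv U b n%:R (H n).
  by move=> Un; apply: (@in_conv_mid _ _ _ n n) => //; rewrite addnn.
move: lenb; rewrite leq_eqVlt => /orP[/eqP nb|ltnb].
  by apply: graph; rewrite nb.
have [/graph //|[n0 Up Us eqi]] := contact n ltnb.
apply: (@in_conv_mid _ _ _ n.-1 n.+1) => //; try lia.
by move: eqi; rewrite /incr /= mulr2n; lra.
Qed.

(** The first increments of a concave sequence are its largest ones, so a sum
    of [k] of them is at most the sum of the first [k]. *)
Lemma sum_incr_le (b : nat) (H : nat -> rat) (P : pred nat) (m : nat) :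
  target_seq b H -> (m <= b)%N ->
  \sum_(i < m | P i) incr H i.+1 <= H (\sum_(i < m | P i) 1)%N.
Proof.
move=> tH; elim: m => [|m IHm] lemb.
  by rewrite !big_ord0; case: tH => ->.
rewrite [X in X <= _]big_mkcond [in leRHS]big_mkcond !big_ord_recr -!big_mkcond /=.
have := IHm (ltnW lemb); set k := (\sum_(i < m | P i) 1)%N.
have lekm : (k <= m)%N.
  rewrite /k big_mkcond -[leqRHS](card_ord m) -sum1_card.
  by apply: leq_sum => i _; case: (P i).
case: (P m); last by rewrite addr0 addn0.
have : incr H m.+1 <= incr H k.+1 by apply: (incr_anti tH); lia.
rewrite addn1 {2}/incr /=; lra.
Qed.

Lemma sum_incr_prefix (b : nat) (H : nat -> rat) (n : nat) :
  target_seq b H -> (n <= b)%N -> \sum_(i < b | (i < n)%N) incr H i.+1 = H n.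
Proof.
move=> [H0 _ _] lenb.
rewrite -(big_ord_widen b (fun i => incr H i.+1) lenb).
elim: n {lenb} => [|n IHn]; first by rewrite big_ord0 H0.
by rewrite big_ord_recr /= IHn /incr /=; lra.
Qed.

(** * Optimal sets *)

Lemma Umax_le (I : instance) (C n : nat) (y : rat) :
  (forall S : {set item I}, #|S| = n -> (set_size S <= C)%N ->
     set_gain S <= y) ->
  (Umax I C n <= y%:E)%E.
Proof.
move=> hS; apply/bigmax_leP; split=> [|S /andP[/eqP cS sS]].
  exact: leNye.
by rewrite lee_fin hS.
Qed.

Lemma Umax_eq (I : instance) (C n : nat) (y : rat) (S : {set item I}) :
  (Umax I C n <= y%:E)%E ->
  #|S| = n -> (set_size S <= C)%N -> set_gain S = y -> Umax I C n = y%:E.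
Proof.
move=> Uy cS sS gS; apply: le_anti; rewrite Uy -gS /=.
by apply: (le_bigmax_cond _ (fun S : {set item I} => (set_gain S)%:E));
  rewrite cS eqxx.
Qed.

(** * The instance *)

Definition gadget_gain (b : nat) (Hr : nat -> rat) (big : seq rat)
    (x : 'I_b + 'I_4) : rat :=
  match x with inl i => incr Hr i.+1 | inr j => big`_j end.

(** Under the capacity [2 b + 3] these sizes allow the two items of size [b + 1]
    together with one unit item, forbid a second one, and make an item of size
    [b + 2] with one of size [b + 1] fill the capacity. *)
Definition gadget_size (b : nat) (x : 'I_b + 'I_4) : nat :=
  match x with
  | inl _ => 1
  | inr j => nth 1%N [:: b.*2 + 3; b + 1; b + 1; b + 2]%N j
  end.

Lemma gadget_size_gt0 (b : nat) (x : 'I_b + 'I_4) : (0 < gadget_size x)%N.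
Proof. by case: x => [//|[[|[|[|[|]]]] hj]] //=; lia. Qed.

Lemma gadget_Rcap_lt (b : nat) : (b < b.*2 + 3)%N.
Proof. by lia. Qed.

Lemma gadget_size_le (b : nat) (x : 'I_b + 'I_4) :
  (gadget_size x <= b.*2 + 3)%N.
Proof. by case: x => [i|[[|[|[|[|]]]] hj]] //=; lia. Qed.

Definition gadget (b : nat) (Hr : nat -> rat) (big : seq rat)
    (gain0 : forall x : 'I_b + 'I_4, 0 <= gadget_gain Hr big x) : instance :=
  Instance gain0 (@gadget_size_gt0 b) (gadget_Rcap_lt b) (@gadget_size_le b).

Lemma sum_incr_set_le (b : nat) (H : nat -> rat) (T : {set 'I_b}) :
  target_seq b H -> \sum_(i in T) incr H i.+1 <= H #|T|.
Proof.
move=> tH; pose P n := oapp (fun i : 'I_b => i \in T) false (insub n).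
have PE (i : 'I_b) : (i \in T) = P i by rewrite /P valK.
by rewrite -sum1_card !(eq_bigl _ _ PE); exact: (sum_incr_le _ tH).
Qed.

Lemma gadget_sum (R : Type) (idx : R) (op : Monoid.com_law idx) (b : nat)
    (F : 'I_b + 'I_4 -> R) (S : {set 'I_b + 'I_4}) :
  \big[op/idx]_(x in S) F x =
  op (\big[op/idx]_(i in [set i | inl i \in S]) F (inl i))
     (\big[op/idx]_(j < 4 | inr j \in S) F (inr j)).
Proof.
by rewrite big_sumType; congr (op _ _); apply: eq_bigl => i; rewrite inE.
Qed.


Definition gadget_set (b : nat) (T : {set 'I_b}) (B : {set 'I_4}) :
    {set 'I_b + 'I_4} :=
  [set x | match x with inl i => i \in T | inr j => j \in B end].

Lemma gadget_set_sum (R : Type) (idx : R) (op : Monoid.com_law idx) (b : nat)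
    (F : 'I_b + 'I_4 -> R) (T : {set 'I_b}) (B : {set 'I_4}) :
  \big[op/idx]_(x in gadget_set T B) F x =
  op (\big[op/idx]_(i in T) F (inl i)) (\big[op/idx]_(j in B) F (inr j)).
Proof.
by rewrite gadget_sum; congr (op _ _); apply: eq_bigl => i; rewrite !inE.
Qed.

(** * Values under the small capacity *)

Lemma gadget_reserve (b : nat) (Hr : nat -> rat) (big : seq rat)
    (gain0 : forall x, 0 <= gadget_gain Hr big x) :
  target_seq b Hr ->
  terminal_count (Ur (@gadget b Hr big gain0)) b /\
  is_hull (Ur (gadget gain0)) b Hr.
Proof.
move=> tHr.
have UH n : (Ur (gadget gain0) n <= (Hr (minn n b))%:E)%E.
  apply: Umax_le => S cS; rewrite /set_size gadget_sum /= sum1_card => sS.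
  have noBig (j : 'I_4) : (inr j \in S) = false.
    apply/negP => jS; move: sS; rewrite (bigD1 j) //=.
    case: j jS => -[|[|[|[|]]]] hj _ //=; lia.
  have cT : #|[set i | inl i \in S]| = n.
    by rewrite -cS -!sum1_card (gadget_sum _ _ S) /= [X in (_ + X)%N]big_pred0 ?addn0.
  rewrite /set_gain gadget_sum /= [X in _ + X]big_pred0 // addr0.
  rewrite (minn_idPl _); first by rewrite -cT; apply: sum_incr_set_le.
  by rewrite -cT -[leqRHS](card_ord b) max_card.
have UE n : (n <= b)%N -> Ur (gadget gain0) n = (Hr n)%:E.
  move=> lenb.
  pose T := [set i : 'I_b | (i < n)%N].
  have cT : #|T| = n.
    by rewrite -sum1dep_card -(big_ord_widen b (fun=> 1%N) lenb) sum1_card card_ord.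
  apply: (@Umax_eq (gadget gain0) _ _ _ (gadget_set T set0)).
  - by have := UH n; rewrite (minn_idPl lenb).
  - by rewrite -sum1_card gadget_set_sum /= big_set0 sum1_card cT addn0.
  - by rewrite /set_size gadget_set_sum /= big_set0 sum1_card cT addn0.
  - rewrite /set_gain gadget_set_sum /= big_set0 addr0 -(sum_incr_prefix tHr lenb).
    by apply: eq_bigl => i; rewrite inE.
by apply: terminal_hull => // [|n /ltnW/UE]; [apply: UE | left].
Qed.

(** * Values under the large capacity *)

Lemma big_ord4 (R : Type) (idx : R) (op : Monoid.law idx) (P : pred 'I_4)
    (F : nat -> R) :
  \big[op/idx]_(j < 4 | P j) F j =
  op (if P (inord 0) then F 0%N else idx)
    (op (if P (inord 1) then F 1%N else idx)
      (op (if P (inord 2) then F 2%N else idx)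
          (if P (inord 3) then F 3%N else idx))).
Proof.
rewrite big_mkcond !big_ord_recl big_ord0 /= Monoid.mulm1.
by do !congr (op _ _); congr (if P _ then _ else _); apply/val_inj;
  rewrite /= inordK.
Qed.

(** Each bound in the hypotheses belongs to one way of combining large items;
    for a single large item it suffices to bound the value with no unit item,
    with one, and with all of them, since [Hw] is capped at count 3. *)
Lemma gadget_upper (br : nat) (Hw Hr : nat -> rat) (l1 l2 q : rat)
    (gain0 : forall x : 'I_br + 'I_4,
       0 <= gadget_gain Hr [:: Hw 1%N; l1; l2; q] x)
    (S : {set item (gadget gain0)}) :
  target_seq br Hr -> dominance 3 br Hw Hr ->
  (forall x, x \in [:: l1; l2; q] ->
     [/\ x <= Hw 1%N, x + Hr 1%N <= Hw 2%N & x + Hr br <= Hw 3%N]) ->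
  l1 + l2 <= Hw 2%N -> l1 + l2 + Hr 1%N <= Hw 3%N ->
  l1 + q <= Hw 2%N -> l2 + q <= Hw 2%N ->
  (set_size S <= Dcap (gadget gain0))%N ->
  set_gain S <= Hw (minn #|S| 3).
Proof.
move=> tHr hdom hone h12 h12r h1q h2q.
have [[u1 v1 w1] [u2 v2 w2] [u3 v3 w3]] :
  [/\ [/\ l1 <= Hw 1%N, l1 + Hr 1%N <= Hw 2%N & l1 + Hr br <= Hw 3%N],
      [/\ l2 <= Hw 1%N, l2 + Hr 1%N <= Hw 2%N & l2 + Hr br <= Hw 3%N]
    & [/\ q <= Hw 1%N, q + Hr 1%N <= Hw 2%N & q + Hr br <= Hw 3%N]].
  by split; apply: hone; rewrite !inE eqxx ?orbT.
rewrite -[in #|S|]sum1_card /set_size /set_gain !(gadget_sum _ _ S) !big_ord4.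
rewrite (big_ord4 _ _ (fun=> 1%N)) /=.
rewrite sum1_card; set T := [set i | _].
pose g : rat := \sum_(i in T) incr Hr i.+1; rewrite -/g.
have lekb : (#|T| <= br)%N by rewrite -[leqRHS](card_ord br) max_card.
have gk : g <= Hr #|T| by apply: sum_incr_set_le.
have gb : g <= Hr br by apply: le_trans gk (target_seq_le tHr _); rewrite lekb /=.
have gw : g <= Hw (minn #|T| 3) by apply: le_trans gk (hdom _ lekb).
have [Hr0 _ _] := tHr.
move: g #|T| lekb gk gb gw => g k lekb gk gb gw.
case: (inr (inord 0) \in S); case: (inr (inord 1) \in S);
  case: (inr (inord 2) \in S); case: (inr (inord 3) \in S) => /= sS.
(* discard the sets of large items that exceed the capacity *)
all: try (exfalso; clear -sS; lia).
all: rewrite ?(addn0, add0n, addr0, add0r).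
(* three counts of unit items: 0, 1, and at least 2, where [Hw] is capped *)
all: case: k lekb gk gb gw sS => [|[|k]] lekb gk gb gw sS;
  try (exfalso; clear -sS; lia).
all: move: gk gw; rewrite ?addn1 /minn /= ?Hr0 => gk gw.
all: lra.
Qed.

(** The four alternatives are the ways to settle count 2: it has no kink, or one
    of three pairs of items attains [Hw 2]. *)
Lemma gadget_work (br : nat) (Hw Hr : nat -> rat) (l1 l2 q : rat)
    (gain0 : forall x : 'I_br + 'I_4,
       0 <= gadget_gain Hr [:: Hw 1%N; l1; l2; q] x) :
  target_seq 3 Hw -> target_seq br Hr -> dominance 3 br Hw Hr -> (0 < br)%N ->
  (forall x, x \in [:: l1; l2; q] ->
     [/\ x <= Hw 1%N, x + Hr 1%N <= Hw 2%N & x + Hr br <= Hw 3%N]) ->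
  l1 + l2 <= Hw 2%N -> l1 + l2 + Hr 1%N = Hw 3%N ->
  l1 + q <= Hw 2%N -> l2 + q <= Hw 2%N ->
  [\/ incr Hw 2 = incr Hw 3, l1 + l2 = Hw 2%N, l1 + Hr 1%N = Hw 2%N
    | l1 + q = Hw 2%N] ->
  terminal_count (Uw (gadget gain0)) 3 /\ is_hull (Uw (gadget gain0)) 3 Hw.
Proof.
move=> tHw tHr hdom br0 hone h12 h12r h1q h2q hvertex.
have [Hw0 _ _] := tHw; have [Hr0 _ _] := tHr.
have UH n : (Uw (gadget gain0) n <= (Hw (minn n 3))%:E)%E.
  by apply: Umax_le => S <- sS; apply: gadget_upper => //; rewrite h12r.
pose r1 : 'I_br := Ordinal br0.
pose o k : 'I_4 := inord k.
have ne (i j : nat) : (i < 4)%N -> (j < 4)%N -> i != j -> o i != o j.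
  by move=> hi hj; apply: contraNneq => /(congr1 val); rewrite /= !inordK // => ->.
have witness n (T : {set 'I_br}) (B : {set 'I_4}) : (n <= 3)%N ->
    (#|T| + #|B| = n)%N ->
    (#|T| + \sum_(j in B) gadget_size (inr j : 'I_br + 'I_4) <= br.*2 + 3)%N ->
    \sum_(i in T) incr Hr i.+1 + \sum_(j in B) [:: Hw 1%N; l1; l2; q]`_j = Hw n ->
    Uw (gadget gain0) n = (Hw n)%:E.
  move=> len3 cS sS gS; apply: (@Umax_eq (gadget gain0) _ _ _ (gadget_set T B)).
  - by have := UH n; rewrite (minn_idPl len3).
  - by rewrite -sum1_card gadget_set_sum /= !sum1_card.
  - by rewrite /set_size gadget_set_sum /= sum1_card.
  - by rewrite /set_gain gadget_set_sum.
have U0 : Uw (gadget gain0) 0 = (Hw 0%N)%:E.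
  by apply: (witness _ set0 set0); rewrite ?cards0 ?big_set0 // addr0 Hw0.
have U1 : Uw (gadget gain0) 1 = (Hw 1%N)%:E.
  apply: (witness _ set0 [set o 0%N]); rewrite ?cards0 ?cards1 ?big_set0 ?big_set1 //=;
  by rewrite inordK // ?add0r ?add0n.
have U3 : Uw (gadget gain0) 3 = (Hw 3%N)%:E.
  have ne12 := ne 1%N 2%N isT isT isT.
  apply: (witness _ [set r1] [set o 1%N; o 2%N]);
    rewrite ?cards1 ?cards2 ?big_set1 ?big_setU1 ?inE ?ne12 ?big_set1 //=;
    rewrite !inordK //=; first by lia.
  by rewrite /incr Hr0 -h12r; lra.
apply: terminal_hull => // -[|[|[|//]]] _; [by left | by left |].
case: hvertex => [eqi|e|e|e]; first by right.
- left; have ne12 := ne 1%N 2%N isT isT isT.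
  apply: (witness _ set0 [set o 1%N; o 2%N]);
    rewrite ?cards0 ?cards2 ?big_set0 ?big_setU1 ?inE ?ne12 ?big_set1 //=;
    rewrite !inordK //=; first by lia.
  by rewrite -e; lra.
- left; apply: (witness _ [set r1] [set o 1%N]);
    rewrite ?cards1 ?big_set1 //= inordK //=; first by lia.
  by rewrite /incr Hr0 -e; lra.
- left; have ne13 := ne 1%N 3%N isT isT isT.
  apply: (witness _ set0 [set o 1%N; o 3%N]);
    rewrite ?cards0 ?cards2 ?big_set0 ?big_setU1 ?inE ?ne13 ?big_set1 //=;
    rewrite !inordK //=; first by lia.
  by rewrite -e; lra.
Qed.

Theorem theoremA3 (br : nat) (Hw Hr : nat -> rat) (lambda1 lambda2 : rat)
    (htarget : target_pair 3 br Hw Hr)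
    (hdom : dominance 3 br Hw Hr)
    (hbr : (1 <= br)%N)
    (h3rho : incr Hw 3 <= incr Hr 1)
    (hl12 : lambda2 <= lambda1)
    (hl2 : 0 < lambda2)
    (hsum : lambda1 + lambda2 = Hw 3%N - incr Hr 1)
    (hl1 : lambda1 <= incr Hw 1)
    (hl1rho : lambda1 + incr Hr 1 <= Hw 2%N)
    (hHr : Hr br <= lambda2 + incr Hr 1)
    (hvertex2 : pos_vertex 3 Hw 2 ->
       [\/ incr Hw 3 = incr Hr 1,
           lambda1 = Hw 2%N - incr Hr 1
         | Num.max (incr Hw 2) (incr Hr 1) <= lambda1 /\
           Hr br <= lambda1 + incr Hw 3]) :
  realizable 3 br Hw Hr.
Proof.
have [tHw tHr] := htarget; have [Hw0 _ _] := tHw; have [Hr0 _ _] := tHr.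
have incr1 H : H 0%N = 0 -> incr H 1 = H 1%N by rewrite /incr => ->; rewrite subr0.
rewrite !incr1 // in h3rho hsum hl1 hl1rho hHr hvertex2.
have i1 : 0 < incr Hw 1 by apply: (incr_gt0 tHw).
have i2 : 0 < incr Hw 2 by apply: (incr_gt0 tHw).
have i3 : 0 < incr Hw 3 by apply: (incr_gt0 tHw).
have j1 : 0 < incr Hr 1 by apply: (incr_gt0 tHr).
rewrite !incr1 // in i1 j1.
have d1 : Hr 1%N <= Hw 1%N by have := hdom 1%N hbr.
have db : Hr br <= Hw 3%N.
  by apply: le_trans (hdom br (leqnn _)) (target_seq_le tHw _); lia.
rewrite /incr /= in h3rho i2 i3.
pose good (q : rat) :=
  [/\ 0 <= q, q <= Hw 1%N, q + Hr 1%N <= Hw 2%N, q + Hr br <= Hw 3%N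
    & lambda1 + q <= Hw 2%N /\
      [\/ incr Hw 2 = incr Hw 3, lambda1 + lambda2 = Hw 2%N,
          lambda1 + Hr 1%N = Hw 2%N | lambda1 + q = Hw 2%N]].
have [q [q0 q1 q2 q3 [q4 hv]]] : exists q, good q.
  have idle : [\/ incr Hw 2 = incr Hw 3, lambda1 + lambda2 = Hw 2%N
                | lambda1 + Hr 1%N = Hw 2%N] -> good 0.
    move=> h; split; try lra; split; first by lra.
    by case: h => h; [constructor 1 | constructor 2 | constructor 3].
  have [e|/eqP ne] := eqVneq (incr Hw 2) (incr Hw 3).
    by exists 0; apply: idle; constructor 1.
  have [e|e|[]] := hvertex2 (conj isT (or_intror ne)).
  - by exists 0; apply: idle; constructor 2; move: e; rewrite /incr /=; lra.
  - by exists 0; apply: idle; constructor 3; lra.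
  rewrite ge_max /incr /= => /andP[m1 m2] m3.
  exists (Hw 2%N - lambda1); split; try lra; split; first by lra.
  by constructor 4; lra.
have gain0 (x : 'I_br + 'I_4) :
    0 <= gadget_gain Hr [:: Hw 1%N; lambda1; lambda2; q] x.
  case: x => [i|[[|[|[|[|]]]] hj]] //=; try lra.
  by apply/ltW/(incr_gt0 tHr); rewrite /= ltn_ord.
exists (gadget gain0).
have [tw hw] : terminal_count (Uw (gadget gain0)) 3 /\
               is_hull (Uw (gadget gain0)) 3 Hw.
  apply: gadget_work => //; try lra.
  by move=> x; rewrite !inE => /or3P[] /eqP->; split; lra.
by have [tr hr] := gadget_reserve gain0 tHr.
Qed.
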